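(* Let $\mathcal{H}(X,Y)\in\mathbb{F}_q[X,Y]$ be a solution to the reduced interpolation problem $\mathbf{RIP}_{1,-1}(\mathcal{P}^*,M^* )$. Then $$\mathcal{Q}(X,Y)=\psi(X)\,\mathcal{H}\!\left(X,\frac{Y-e(X)}{g(X)}\right)$$ is a solution to the original interpolation problem $\mathbf{IP}_{1,k-1}(\mathcal{P},M)$.
   Context: $\mathbb{F}_q$ is the finite field with $q$ elements, $\mathcal{D}\subseteq\mathbb{F}_q$ is an evaluation set, and $1\le k\le|\mathcal{D}|$ is an integer. For integer weights $w_X,w_Y$ (possibly negative), the $(w_X,w_Y)$-weighted degree $\deg_{w_X,w_Y}\mathcal{A}$ of a nonzero $\mathcal{A}=\sum a_{i,j}X^iY^j\in\mathbb{F}_q[X,Y]$ is $\max\{iw_X+jw_Y : a_{i,j}\ne0\}$. For nonzero $\mathcal{A}$ and $(\alpha,\beta)\in\mathbb{F}_q^2$, writing $\mathcal{A}=\sum a_{i,j}(X-\alpha)^i(Y-\beta)^j$, let $\mu_{\alpha,\beta}(\mathcal{A})=\min\{i+j : a_{i,j}\neq0\}$. For $m\in\mathbb{Z}$, $[m]^+=\max\{m,0\}$. Points and original problem: $\mathcal{P}=\{(x_1,y_1),\dots,(x_s,y_s)\}$ is a set of $s$ distinct points with $x_i\in\mathcal{D}$, $y_i\in\mathbb{F}_q$ (the $x_i$ need not be distinct), with positive integer multiplicities $M=\{m_{x_1,y_1},\dots,m_{x_s,y_s}\}$. A solution to $\mathbf{IP}_{1,k-1}(\mathcal{P},M)$ is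 a nonzero $\mathcal{Q}\in\mathbb{F}_q[X,Y]$ with $\mu_{x_i,y_i}(\mathcal{Q})\ge m_{x_i,y_i}$ for all $(x_i,y_i)\in\mathcal{P}$ whose $(1,k-1)$-weighted degree is minimal among all nonzero polynomials satisfying these constraints. Re-encoding: it is assumed that $x_1,\dots,x_k$ are pairwise distinct; $\mathcal{R}=\{(x_1,y_1),\dots,(x_k,y_k)\}\subseteq\mathcal{P}$ is the re-encoding point set, $\nu_i=m_{x_i,y_i}$ for $1\le i\le k$, and $e(X)\in\mathbb{F}_q[X]$ is the unique polynomial of degree $<k$ with $e(x_i)=y_i$ for $1\le i\le k$. Define $g(X)=\prod_{i=1}^k(X-x_i)$, $\psi(X)=\prod_{i=1}^k(X-x_i)^{\nu_i}$, and $t_j(X)=\prod_{i=1}^k(X-x_i)^{[j-\nu_i]^+}$ for $j\ge0$. Let $g'$ be the derivative of $g$. Reduced problem: let $\mathcal{S}$ (resp. $\mathcal{T}$) be the set of points of $\mathcal{P}\setminus\mathcal{R}$ whose $X$-coordinate is not (resp. is) among $x_1,\dots,x_k$. For $(x,y)\in\mathcal{P}\setminus\mathcal{R}$ put $z=(y-e(x))/g(x)$ if $(x,y)\in\mathcal{S}$ and $z=(y-e(x))/g'(x)$ if $(x,y)\in\mathcal{T}$. Let $\mathcal{S}^*,\mathcal{T}^*$ be the sets of resulting points $(x,z)$ coming from $\mathcal{S}$ and $\mathcal{T}$ respectively, $\mathcal{P}^*=\mathcal{S}^*\cup\mathcal{T}^*$, and assign to each $(x,z)\in\mathcal{P}^*$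 the multiplicity $m_{x,z}$ equal to the multiplicity $m_{x,y}$ of the point $(x,y)$ it comes from; $M^*$ is the collection of these multiplicities. A solution to $\mathbf{RIP}_{1,-1}(\mathcal{P}^*,M^* )$ is a nonzero $\mathcal{H}\in\mathbb{F}_q[X,Y]$ such that: (1) $\mathcal{H}(X,Y)=\sum_{j\ge0}q_j(X)t_j(X)Y^j$ for some $q_j(X)\in\mathbb{F}_q[X]$; (2) $\mu_{x,z}(\mathcal{H})\ge m_{x,z}$ for all $(x,z)\in\mathcal{S}^*$; (3) for all $(x,z)\in\mathcal{T}^*$, with $i\in\{1,\dots,k\}$ the index such that $x=x_i$, $\mu_{x,z}\big((X-x)^{\nu_i}\mathcal{H}(X,\tfrac{Y}{X-x})\big)\ge m_{x,z}$ (the argument is a polynomial by (1)); and $\deg_{1,-1}\mathcal{H}$ is minimal among all nonzero polynomials satisfying (1)–(3). *)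

(* Defs.v *)
From HB Require Import structures.
From mathcomp Require Import all_boot all_order all_algebra.
Set Implicit Arguments.
Unset Strict Implicit.
Unset Printing Implicit Defensive.
Import Order.TTheory GRing.Theory Num.Theory.
Local Open Scope ring_scope.

(* Encoding of F[X,Y]: {poly {poly F}}, where the outer variable is Y and the
   coefficients are polynomials in X.  The coefficient of X^i Y^j in A is
   A`_j`_i. *)

Section Bivariate.
Variable F : fieldType.

Definition monomials (A : {poly {poly F}}) : seq (nat * nat) :=
  [seq ij <- [seq (i, j) | j <- iota 0 (size A), i <- iota 0 (size A`_j)]
     | A`_(ij.2)`_(ij.1) != 0].

(* The big operators below start from the first element of the list, so that
   they compute the genuine extremum when A != 0; both are 0 when A = 0. *)

Definition wdeg (wX wY : int) (A : {poly {poly F}}) : int :=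
  let s := [seq (ij.1)%:Z * wX + (ij.2)%:Z * wY | ij <- monomials A] in
  \big[Order.max/head 0 s]_(d <- s) d.

(* A(X + a, Y + b): its coefficient at X^i Y^j is the coefficient of
   (X - a)^i (Y - b)^j in the expansion of A around (a, b). *)
Definition shiftXY (a b : F) (A : {poly {poly F}}) : {poly {poly F}} :=
  map_poly (comp_poly ('X + a%:P)) A \Po ('X + (b%:P)%:P).

Definition mu (a b : F) (A : {poly {poly F}}) : nat :=
  let s := [seq (ij.1 + ij.2)%N | ij <- monomials (shiftXY a b A)] in
  \big[minn/head 0%N s]_(d <- s) d.

(* Passage from F[X][Y] to F(X)[Y], in which substitutions such as
   Y := (Y - e(X)) / g(X) take place. *)
Definition toFX (A : {poly {poly F}}) : {poly {fraction {poly F}}} :=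
  map_poly (@tofrac {poly F}) A.

End Bivariate.

Section Interpolation.
Variable F : finFieldType.
Implicit Types (P : {set F * F}) (m : F * F -> nat) (A Q H : {poly {poly F}}).

Definition minimal_wdeg (wX wY : int) (C : {poly {poly F}} -> Prop) Q : Prop :=
  C Q /\ forall A, C A -> wdeg wX wY Q <= wdeg wX wY A.

Definition IP_feasible P m Q : Prop :=
  Q != 0 /\ forall p, p \in P -> (m p <= mu p.1 p.2 Q)%N.

Definition IP_solution (wX wY : int) P m Q : Prop :=
  minimal_wdeg wX wY (IP_feasible P m) Q.

Variables (k : nat) (x y : 'I_k -> F).

Definition reencoding_points : {set F * F} := [set (x i, y i) | i : 'I_k].

Definition nodal : {poly F} := \prod_(i < k) ('X - (x i)%:P).

Definition psi (nu : 'I_k -> nat) : {poly F} :=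
  \prod_(i < k) ('X - (x i)%:P) ^+ nu i.

(* The exponent is a truncated subtraction, i.e. max(j - nu i, 0). *)
Definition tpoly (nu : 'I_k -> nat) (j : nat) : {poly F} :=
  \prod_(i < k) ('X - (x i)%:P) ^+ (j - nu i).

Definition S_points P : {set F * F} :=
  [set p in P :\: reencoding_points | p.1 \notin codom x].

Definition T_points P : {set F * F} :=
  [set p in P :\: reencoding_points | p.1 \in codom x].

Definition reduce_point (e : {poly F}) (p : F * F) : F * F :=
  (p.1, (p.2 - e.[p.1]) /
        (if p.1 \in codom x then nodal^`().[p.1] else nodal.[p.1])).

Definition S_star P e : {set F * F} := reduce_point e @: S_points P.

Definition T_star P e : {set F * F} := reduce_point e @: T_points P.

(* Multiplicity of the point of P \ R from which the reduced point pz comes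
   (there is exactly one such point when pz lies in S_star or T_star). *)
Definition m_star P m (e : {poly F}) (pz : F * F) : nat :=
  if [pick p in P :\: reencoding_points | reduce_point e p == pz] is Some p
  then m p else 0%N.

Definition RIP_feasible (nu : 'I_k -> nat) (S T : {set F * F}) m H : Prop :=
  [/\ H != 0,
      exists (n : nat) (q : nat -> {poly F}),
        H = \sum_(j < n) (q j * tpoly nu j) *: 'X^j,
      forall p, p \in S -> (m p <= mu p.1 p.2 H)%N
    & forall p (i : 'I_k), p \in T -> p.1 = x i ->
        exists A,
          toFX A = tofrac (('X - (p.1)%:P) ^+ nu i)
                     *: (toFX H \Po ((tofrac ('X - (p.1)%:P))^-1 *: 'X))
          /\ (m p <= mu p.1 p.2 A)%N].

Definition RIP_solution (wX wY : int) (nu : 'I_k -> nat) (S T : {set F * F})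
    m H : Prop :=
  minimal_wdeg wX wY (RIP_feasible nu S T m) H.

End Interpolation.

(* Main.v *)
(* Substituting Y := Y + e(X) changes neither the (1, k-1)-degree (as deg e < k)
   nor the multiplicities (up to moving the points), and turns the reencoding
   points into (x_i, 0).  For B(X, Y) = psi(X) H(X, Y / g(X)), that is
   B_j g^j = psi H_j on Y-coefficients, multiplicity nu_i of B at (x_i, 0) means
   that (X - x_i)^[nu_i - j]^+ divides B_j, and this is equivalent to t_j | H_j.
   At the other points B and H (or its variant in condition (3)) differ by a
   scaling Y -> c(X) Y and a factor d(X) with c, d invertible at the abscissa, so
   multiplicities agree.  Hence both feasible sets correspond, and since the
   weighted degrees differ by the constant deg psi, minimality is transferred. *)
Require Import Defs.
From HB Require Import structures.
From mathcomp Require Import all_boot all_order all_algebra.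
From mathcomp Require Import zify ring.
Set Implicit Arguments.
Unset Strict Implicit.
Unset Printing Implicit Defensive.
Import Order.TTheory GRing.Theory Num.Theory.
Local Open Scope ring_scope.

(** The seed [head t0 s] is itself an entry of a nonempty [s], so it adds no condition. One
    statement serves both the maximum in [wdeg] and the minimum in [mu]. *)
Lemma big_head_all (T : Type) (op : T -> T -> T) (p : pred T) (t0 : T) (s : seq T) :
    (forall a b, p (op a b) = p a && p b) -> (0 < size s)%N ->
  p (\big[op/head t0 s]_(c <- s) c) = all p s.
Proof.
move=> op_p; case: s => //= a s _.
have E r : p (\big[op/a]_(c <- r) c) = all p r && p a.
  by elim: r => [|b r IH]; rewrite ?big_nil // big_cons op_p IH andbA.
by rewrite E /= andbAC andbb.
Qed.

(** * Bounds on weighted degrees, for weights of any sign *)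

Section WeightBound.
Variable F : fieldType.
Implicit Types (A B C : {poly {poly F}}) (u v d : int).

(** Unlike [wdeg], this also behaves well at 0, which satisfies every bound. Allowing negative
    weights lets the same calculus treat degrees and, with weights (-1, -1), multiplicities. *)
Definition weight_le u v d A :=
  forall i j, d < i%:Z * u + j%:Z * v -> A`_j`_i = 0.

Lemma mem_monomials A ij : (ij \in monomials A) = (A`_(ij.2)`_(ij.1) != 0).
Proof.
rewrite mem_filter; case: eqVneq => //= nz; apply/allpairsPdep.
exists ij.2, ij.1; split; last by case: (ij).
- rewrite mem_iota /= add0n ltnNge; apply: contraNN nz => le.
  by rewrite (nth_default _ le) coefC if_same.
- by rewrite mem_iota /= add0n ltnNge; apply: contraNN nz => le; rewrite nth_default.
Qed.

Lemma size_monomials_gt0 A : A != 0 -> (0 < size (monomials A))%N.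
Proof.
move=> nz; rewrite lt0n size_eq0; apply/eqP => E.
have := mem_monomials A ((size (A`_(size A).-1)).-1, (size A).-1).
by rewrite E in_nil /= -[_`_ (_ .-1)]lead_coefE -lead_coefE !lead_coef_eq0 nz.
Qed.

Lemma wdeg_leP u v d A : A != 0 -> reflect (weight_le u v d A) (wdeg u v A <= d).
Proof.
move=> nz; rewrite /wdeg (big_head_all (p := fun c => c <= d)); first last.
- by rewrite size_map size_monomials_gt0.
- by move=> a b; rewrite ge_max.
apply: (iffP allP) => [le i j lt|W c /mapP[ij]].
  apply: contraTeq lt => nzA; rewrite -leNgt; apply: le.
  by apply/mapP; exists (i, j); rewrite ?mem_monomials.
rewrite mem_monomials => nzA ->; rewrite leNgt.
by apply: contraNN nzA => /W ->.
Qed.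

Lemma weight_le_polyC u v d (p : {poly F}) :
  (forall i, d < i%:Z * u -> p`_i = 0) -> weight_le u v d p%:P.
Proof.
move=> h i [|j]; rewrite coefC /= ?coef0 // => lt; apply: h.
by rewrite mul0r addr0 in lt.
Qed.

Lemma weight_leD u v d A B :
  weight_le u v d A -> weight_le u v d B -> weight_le u v d (A + B).
Proof. by move=> hA hB i j lt; rewrite !coefD hA // hB // addr0. Qed.

Lemma weight_leM u v d d' A B :
  weight_le u v d A -> weight_le u v d' B -> weight_le u v (d + d') (A * B).
Proof.
move=> hA hB i j lt; rewrite coefM coef_sum big1 // => l _.
rewrite coefM big1 // => h _.
have [leA|/hA -> //] := lerP (h%:Z * u + l%:Z * v) d; last by rewrite mul0r.
rewrite hB ?mulr0 // -subzn -1?ltnS // -subzn -1?ltnS //.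
have: d + d' - (h%:Z * u + l%:Z * v) > d' - 0 + (d - (h%:Z * u + l%:Z * v)) - 1 by lia.
rewrite !mulrBl; lia.
Qed.

Lemma weight_leX u v d A n : weight_le u v d A -> weight_le u v (n%:Z * d) (A ^+ n).
Proof.
move=> hA; elim: n => [|n IH]; last first.
  by rewrite exprS -addn1 PoszD mulrDl mul1r addrC; apply: weight_leM.
rewrite mul0r expr0; apply: weight_le_polyC => i.
by rewrite coefC; case: i => [|i] //=; rewrite mul0r ltxx.
Qed.

(** Y has weight [v], so replacing it by some [C] of weight at most [v] cannot raise the weight of
    any monomial. *)
Lemma weight_le_comp u v d A C :
  weight_le u v d A -> weight_le u v v C -> weight_le u v d (A \Po C).
Proof.
move=> hA hC; rewrite comp_polyE.
apply: (big_ind (weight_le u v d)) => [|A1 A2|j _].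
- by move=> i j _; rewrite !coef0.
- exact: weight_leD.
(* In [d = (d - j v) + j v] the first summand bounds the coefficient of Y^j, the second bounds
   [C ^+ j]. *)
rewrite -mul_polyC -[d](subrK (j%:Z * v)).
apply: weight_leM; last exact: weight_leX.
by apply: weight_le_polyC => i lt; apply: hA; rewrite -ltrBlDr.
Qed.

Lemma weight_le_shiftY (k : nat) d A (e : {poly F}) : (size e <= k)%N ->
  weight_le 1 (k%:Z - 1) d A -> weight_le 1 (k%:Z - 1) d (A \Po ('X + e%:P)).
Proof.
move=> size_e W; apply: weight_le_comp W _; apply: weight_leD => i j lt; last first.
  case: j lt => [|j] lt; rewrite coefC /= ?coef0 // nth_default //.
  by apply: leq_trans size_e _; lia.
rewrite coefX; case: eqP lt => [->|_ _]; last exact: coef0.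
by rewrite coefC; case: i => //=; lia.
Qed.

End WeightBound.

(** * Multiplicities and their behaviour under substitutions in Y *)

Section Vanishing.
Variable F : fieldType.
Implicit Types (A B C : {poly {poly F}}) (a b z : F) (c d : {poly F}) (n : nat).

(* Membership of A in the n-th power of the ideal (X - a, Y - b). *)
Definition vanishes a b n A := weight_le (-1) (-1) (- n%:Z) (shiftXY a b A).

Lemma shiftXY_eq0 a b A : (shiftXY a b A == 0) = (A == 0).
Proof.
rewrite comp_poly_eq0 ?size_XaddC // -!size_poly_eq0 size_map_inj_poly ?comp_poly0 //.
exact: can_inj (fun p => comp_polyXaddC_K p a).
Qed.

Lemma vanishesP a b n A : A != 0 -> reflect (vanishes a b n A) (n <= mu a b A)%N.
Proof.
move=> nz; rewrite /mu (big_head_all (p := leq n)); first last.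
- by rewrite size_map size_monomials_gt0 // shiftXY_eq0.
- by move=> i j; rewrite leq_min.
apply: (iffP allP) => [le i j lt|W c /mapP[[i j]]].
  apply: contraTeq lt => nzA; rewrite -leNgt.
  have: (n <= i + j)%N.
    by apply: le; apply/mapP; exists (i, j); rewrite ?mem_monomials.
  lia.
rewrite mem_monomials => /= nzA ->; rewrite leqNgt.
by apply: contraNN nzA => lt; rewrite W //; lia.
Qed.

Lemma vanishes0 a b n : vanishes a b n 0.
Proof. by move=> i j _; rewrite (eqP (_ : shiftXY a b 0 == 0)) ?shiftXY_eq0 // !coef0. Qed.

Lemma vanishes_mu a b n A : (n <= mu a b A)%N -> vanishes a b n A.
Proof.
by have [-> _|nz /(vanishesP a b n nz)] := eqVneq A 0; first exact: vanishes0.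
Qed.

Lemma shiftXYM a b A B : shiftXY a b (A * B) = shiftXY a b A * shiftXY a b B.
Proof. by rewrite /shiftXY rmorphM comp_polyM. Qed.

Lemma shiftXYD a b A B : shiftXY a b (A + B) = shiftXY a b A + shiftXY a b B.
Proof. by rewrite /shiftXY rmorphD comp_polyD. Qed.

Lemma shiftXYC a b c : shiftXY a b c%:P = (c \Po ('X + a%:P))%:P.
Proof. by rewrite /shiftXY map_polyC comp_polyC. Qed.

(** The centre [b] is free here; the useful choice is b = C(a, z), for which the inner polynomial
    has no constant term. *)
Lemma shiftXY_comp a b z B C :
  shiftXY a z (B \Po C) = shiftXY a b B \Po (shiftXY a z C - b%:P%:P).
Proof.
rewrite /shiftXY map_comp_poly -!comp_polyA comp_polyD comp_polyX comp_polyC.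
by rewrite subrK.
Qed.

Lemma coef00_shiftXY a z C : (shiftXY a z C)`_0`_0 = C.[z%:P].[a].
Proof.
rewrite -!horner_coef0 /shiftXY horner_comp hornerD hornerX hornerC add0r.
by rewrite -{1}(comp_polyC z ('X + a%:P)) horner_map horner_comp !hornerE.
Qed.

Lemma vanishesD a b n A B :
  vanishes a b n A -> vanishes a b n B -> vanishes a b n (A + B).
Proof. by rewrite /vanishes shiftXYD; apply: weight_leD. Qed.

Lemma vanishesZ a b n c A : vanishes a b n A -> vanishes a b n (c *: A).
Proof.
move=> vA; rewrite -mul_polyC /vanishes shiftXYM -[- n%:Z]add0r.
by apply: weight_leM; [move=> i j; lia | exact: vA].
Qed.

Lemma vanishes_XsubC a b n A : vanishes a b n (('X - a%:P) ^+ n *: A).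
Proof.
rewrite -mul_polyC /vanishes shiftXYM -[- n%:Z]addr0; apply: weight_leM => [|i j]; last lia.
rewrite shiftXYC rmorphXn /= rmorphB /= comp_polyX comp_polyC addrK.
apply: weight_le_polyC => i lt; rewrite coefXn; case: eqP => // ?; lia.
Qed.

Lemma vanishes_comp a z n B C :
  vanishes a C.[z%:P].[a] n B -> vanishes a z n (B \Po C).
Proof.
move=> vB; rewrite /vanishes (shiftXY_comp _ C.[z%:P].[a]).
apply: weight_le_comp vB _ => i j lt.
(* Only the constant monomial has weight above -1, and its coefficient is C(a, z) - C(a, z). *)
have [-> ->]: i = 0%N /\ j = 0%N by lia.
by rewrite !coefB !coefC /= coef00_shiftXY subrr.
Qed.

(** Multiples of (X - a)^n already vanish to order [n] on the line X = a, so an inverse modulo this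
    power is as good as a true inverse. *)
Lemma invertible_mod_XsubC a n c : c.[a] != 0 ->
  exists u w, u * c = 1 + w * ('X - a%:P) ^+ n.
Proof.
move=> nz; have: coprimep c (('X - a%:P) ^+ n).
  by rewrite coprimep_expr // coprimep_XsubC.
case/Bezout_eq1_coprimepP => -[u w] /= E; exists u, (- w).
by rewrite -E mulNr addrK.
Qed.

Lemma vanishesZ_inv a b n c A :
  c.[a] != 0 -> vanishes a b n (c *: A) -> vanishes a b n A.
Proof.
case/(invertible_mod_XsubC n) => u [w E] v.
have ->: A = u *: (c *: A) + (('X - a%:P) ^+ n) *: ((- w) *: A).
  by rewrite !scalerA E -scalerDl mulrN mulrC addrK scale1r.
by apply: vanishesD; [exact: vanishesZ | exact: vanishes_XsubC].
Qed.

Lemma coef_comp_scaleX (R : comNzRingType) (p : {poly R}) r j :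
  (p \Po (r *: 'X))`_j = p`_j * r ^+ j.
Proof.
rewrite coef_comp_poly; under eq_bigr do rewrite exprZn coefZ coefXn.
have [lt|le] := ltnP j (size p); last first.
  rewrite big1 ?nth_default ?mul0r // => i _.
  by rewrite (gtn_eqF (leq_trans (ltn_ord i) le)) !mulr0.
rewrite (bigD1 (Ordinal lt)) //= eqxx mulr1 big1 ?addr0 // => i.
by rewrite -val_eqE eq_sym /= => /negbTE ->; rewrite !mulr0.
Qed.

(** The scaling Y -> c Y is undone by Y -> u Y, with [u] inverse to [c] modulo a power of X - a; the
    error is a multiple of (X - a)^n. *)
Lemma vanishes_comp_scaleX_inv a z n c B : c.[a] != 0 ->
  vanishes a z n (B \Po (c *: 'X)) -> vanishes a (c.[a] * z) n B.
Proof.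
(* The exponent [n.+1] is positive even for n = 0, so that u(a) c(a) = 1 follows by evaluation. *)
move=> nz v; have [u [w E]] := invertible_mod_XsubC n.+1 nz.
have ua : u.[a] * c.[a] = 1.
  by rewrite -hornerM E !hornerE subrr expr0n mulr0 addr0.
have vu: vanishes a (c.[a] * z) n (B \Po ((u * c) *: 'X)).
  have ->: (u * c) *: 'X = (c *: 'X) \Po (u *: 'X) :> {poly {poly F}}.
    by rewrite comp_polyZ comp_polyX scalerA mulrC.
  rewrite comp_polyA; apply: vanishes_comp.
  by rewrite hornerZ hornerX hornerM hornerC mulrA ua mul1r.
(* The coefficient of Y^j in the error is -((u c)^j - 1) B_j. Factoring out u c - 1 = w (X -
   a)^(n+1), and then (X - a)^n, leaves [R]. *)
pose R := \poly_(j < size B)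
  (- (w * ('X - a%:P) * B`_j * \sum_(i < j) (u * c) ^+ i)).
suff ->: B = (B \Po ((u * c) *: 'X)) + ('X - a%:P) ^+ n *: R.
  by apply: vanishesD => //; apply: vanishes_XsubC.
apply/polyP => j; rewrite coefD coefZ coef_comp_scaleX coef_poly.
case: ltnP => le; last by rewrite nth_default // mul0r mulr0 addr0.
have := subrX1 (u * c) j; set s := \sum_(i < j) _; rewrite {2}E [1 + _]addrC addrK.
move=> /(canRL (subrK _)) ->; rewrite exprS; ring.
Qed.

(** Used with c = g, d = psi away from the nodes, and at a node with the cofactors of X - x_i in g
    and psi. *)
Lemma vanishes_link a z n c d A B :
    c.[a] != 0 -> d.[a] != 0 -> B \Po (c *: 'X) = d *: A ->
  vanishes a z n A <-> vanishes a (c.[a] * z) n B.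
Proof.
move=> c_nz d_nz E; split=> v.
  by apply: vanishes_comp_scaleX_inv => //; rewrite E; apply: vanishesZ.
apply: (vanishesZ_inv d_nz); rewrite -E; apply: vanishes_comp.
by rewrite hornerZ hornerX hornerM hornerC.
Qed.

Lemma vanishes_shiftY a b n (e : {poly F}) A :
  vanishes a b n A <-> vanishes a (b - e.[a]) n (A \Po ('X + e%:P)).
Proof.
split=> v.
  by apply: vanishes_comp; rewrite hornerD hornerX hornerC hornerD hornerC subrK.
rewrite -[A]comp_polyXr -['X](subrK e%:P) -[X in _ \Po X]addrA.
have ->: 'X + (- e%:P + e%:P) = ('X + e%:P) \Po ('X - e%:P).
  by rewrite comp_polyD comp_polyX comp_polyC addrA.
rewrite comp_polyA; apply: vanishes_comp.
by rewrite hornerD hornerX hornerN hornerC hornerD hornerN hornerC.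
Qed.

(** Centring at ordinate 0 shifts only X, so the condition splits into one for each power of Y. *)
Lemma vanishes_axisP a n A :
  vanishes a 0 n A <-> forall j, ('X - a%:P) ^+ (n - j) %| A`_j.
Proof.
have E: shiftXY a 0 A = map_poly (comp_poly ('X + a%:P)) A.
  by rewrite /shiftXY !polyC0 addr0 comp_polyXr.
have unshift (p : {poly F}) : (p \Po ('X + a%:P)) \Po ('X - a%:P) = p.
  exact: comp_polyXaddC_K.
split=> [v j|dv i j lt]; last first.
  rewrite E coef_map /=; have /dvdpP[q ->] := dv j.
  rewrite rmorphM rmorphXn /= rmorphB /= comp_polyX comp_polyC addrK coefMXn.
  by case: ifP => //; lia.
set p := A`_j \Po ('X + a%:P).
have Ep: p = drop_poly (n - j) p * 'X^(n - j).
  rewrite -{1}[p](poly_take_drop (n - j)); suff -> : take_poly (n - j) p = 0 by rewrite add0r.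
  apply/polyP => i; rewrite coef_take_poly coef0; case: ltnP => // lt.
  by have := v i j; rewrite E coef_map; apply; lia.
rewrite -[A`_j]unshift -/p Ep rmorphM rmorphXn /= comp_polyX.
by rewrite dvdp_mull.
Qed.

End Vanishing.

(** * Coefficientwise criteria for degrees, denominators and divisibility *)

Lemma weight_le1P (F : fieldType) (v d : int) (A : {poly {poly F}}) :
  weight_le 1 v d A <-> forall j, A`_j != 0 -> (size A`_j).-1%:Z + j%:Z * v <= d.
Proof.
split=> [W j nz|h i j lt].
  rewrite leNgt; apply: contraNN nz => lt.
  by rewrite -lead_coef_eq0 lead_coefE W // mulr1.
apply/eqP; rewrite -[_ == 0]negbK; apply/negP => nz.
have ltsz : (i < size (A`_j)%R)%N.
  by rewrite ltnNge; apply: contraNN nz => le; rewrite nth_default.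
have nzA : A`_j != 0 by apply: contraNN nz => /eqP ->; rewrite coef0.
have := h j nzA; lia.
Qed.

(** Clearing the denominator [c ^+ j] brings substitutions over F(X) back to identities in F[X]: c =
    g gives [linked], c = X - x_i gives condition (3). *)
Lemma toFX_scaleP (F : fieldType) (A H : {poly {poly F}}) (c d : {poly F}) :
    c != 0 ->
  toFX A = tofrac d *: (toFX H \Po ((tofrac c)^-1 *: 'X)) <->
  forall j, A`_j * c ^+ j = d * H`_j.
Proof.
move=> nz.
have nzX j : tofrac c ^+ j != 0 :> {fraction {poly F}}.
  by rewrite expf_neq0 // tofrac_eq0.
split=> [E j|E]; last apply/polyP => j.
  apply/eqP; rewrite -tofrac_eq !tofracM tofracXn; apply/eqP.
  move/polyP/(_ j): E; rewrite coefZ coef_comp_scaleX !coef_map /= => ->.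
  by rewrite exprVn -!mulrA mulVf // mulr1.
rewrite coefZ coef_comp_scaleX !coef_map /= exprVn.
apply: (mulIf (nzX j)); rewrite -!mulrA mulVf // mulr1.
by rewrite -tofracXn -!tofracM E.
Qed.

Lemma dvdp_prod_coprime (F : fieldType) (I : finType) (f : I -> {poly F}) p :
    (forall i j, i != j -> coprimep (f i) (f j)) -> (forall i, f i %| p) ->
  \prod_i f i %| p.
Proof.
move=> co dv; elim: (index_enum I) (index_enum_uniq I) => [|i s IH] /=.
  by rewrite big_nil dvd1p.
case/andP=> si /IH{IH} dvs; rewrite big_cons Gauss_dvdp ?dv //.
rewrite big_seq; apply: (big_ind (coprimep (f i))) => [|q r|j sj].
- exact: coprimep1.
- by rewrite coprimepMr => -> ->.
- by apply: co; apply: contraNneq si => ->.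
Qed.

(** * The correspondence between B and H through psi and g *)

Section Reencoding.
Variables (F : finFieldType) (k : nat) (x : 'I_k -> F) (nu : 'I_k -> nat).
Hypothesis x_inj : injective x.
Implicit Types (A B H : {poly {poly F}}).

Local Notation g := (nodal x).

(** The divisor forced on B_j by multiplicities [nu i] at the points (x_i, 0), as [tpoly] is the one
    imposed on H_j. *)
Definition cotpoly (j : nat) : {poly F} := \prod_(i < k) ('X - (x i)%:P) ^+ (nu i - j).

Definition nodal_except i : {poly F} := \prod_(l < k | l != i) ('X - (x l)%:P).

Definition psi_except i : {poly F} := \prod_(l < k | l != i) ('X - (x l)%:P) ^+ nu l.

(* The coefficientwise form of B(X, Y) = psi(X) H(X, Y / g(X)). *)
Definition linked B H := forall j, B`_j * g ^+ j = psi x nu * H`_j.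

Definition axis_divisible B :=
  forall i j, ('X - (x i)%:P) ^+ (nu i - j) %| B`_j.

Definition t_form H :=
  exists (n : nat) (q : nat -> {poly F}), H = \sum_(j < n) (q j * tpoly x nu j) *: 'X^j.

Lemma nodal_neq0 : g != 0.
Proof. by apply/prodf_neq0 => i _; rewrite polyXsubC_eq0. Qed.

Lemma psi_neq0 : psi x nu != 0.
Proof. by apply/prodf_neq0 => i _; rewrite expf_neq0 // polyXsubC_eq0. Qed.

Lemma size_nodal : size g = k.+1.
Proof. by rewrite size_prod_XsubC /index_enum -enumT size_enum_ord. Qed.

Lemma nodalE i : g = ('X - (x i)%:P) * nodal_except i.
Proof. by rewrite /nodal (bigD1 i). Qed.

Lemma psiE i : psi x nu = ('X - (x i)%:P) ^+ nu i * psi_except i.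
Proof. by rewrite /psi (bigD1 i). Qed.

Lemma nodal_except_neq0 i : (nodal_except i).[x i] != 0.
Proof.
rewrite horner_prod; apply/prodf_neq0 => l neq.
by rewrite hornerXsubC subr_eq0 (inj_eq x_inj) eq_sym.
Qed.

Lemma psi_except_neq0 i : (psi_except i).[x i] != 0.
Proof.
rewrite horner_prod; apply/prodf_neq0 => l neq.
by rewrite horner_exp hornerXsubC expf_neq0 // subr_eq0 (inj_eq x_inj) eq_sym.
Qed.

(** This explains the derivative in the reduced points of T: after removal of X - x_i from g, the
    remaining scaling factor has value g'(x_i) at the node. *)
Lemma deriv_nodal i : g^`().[x i] = (nodal_except i).[x i].
Proof. by rewrite (nodalE i) derivM derivXsubC !hornerE subrr mul0r addr0. Qed.

Lemma nodal_off_nodes a : a \notin codom x -> g.[a] != 0.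
Proof.
move=> na; rewrite horner_prod; apply/prodf_neq0 => l _.
by rewrite hornerXsubC subr_eq0; apply: contraNneq na => ->; apply: codom_f.
Qed.

Lemma psi_off_nodes a : a \notin codom x -> (psi x nu).[a] != 0.
Proof.
move=> na; rewrite horner_prod; apply/prodf_neq0 => l _.
rewrite horner_exp hornerXsubC expf_neq0 // subr_eq0.
by apply: contraNneq na => ->; apply: codom_f.
Qed.

(** On exponents: [nu_i - j]^+ + j = nu_i + [j - nu_i]^+. Hence B_j and H_j share the same quotient
    q_j by [cotpoly j] and [tpoly x nu j]. *)
Lemma cotpoly_nodal j : cotpoly j * g ^+ j = psi x nu * tpoly x nu j.
Proof.
rewrite /nodal -prodrXl -!big_split; apply: eq_bigr => i _ /=.
by rewrite -!exprD; congr (_ ^+ _); lia.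
Qed.

Lemma cotpoly_dvd B j : axis_divisible B -> cotpoly j %| B`_j.
Proof.
move=> dv; apply: dvdp_prod_coprime => [i l neq|i]; last exact: dv.
apply: coprimep_expl; apply: coprimep_expr; apply: coprimep_XsubC2.
by rewrite subr_eq0 (inj_eq x_inj) eq_sym.
Qed.

Lemma t_form_linked H : t_form H -> exists B, axis_divisible B /\ linked B H.
Proof.
case=> n [q ->]; rewrite -(poly_def n (fun j => q j * tpoly x nu j)).
exists (\poly_(j < n) (q j * cotpoly j)); split=> [i j|j]; rewrite !coef_poly.
  case: ifP => _; last exact: dvdp0.
  by rewrite dvdp_mull // /cotpoly (bigD1 i) //= dvdp_mulr.
case: ifP => _; last by rewrite mul0r mulr0.
by rewrite -mulrA cotpoly_nodal mulrCA.
Qed.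

Lemma axis_divisible_linked B : axis_divisible B -> exists H, t_form H /\ linked B H.
Proof.
move=> dv; pose q j := B`_j %/ cotpoly j.
exists (\sum_(j < size B) (q j * tpoly x nu j) *: 'X^j).
split=> [|j]; first by exists (size B), q.
rewrite -(poly_def _ (fun j => q j * tpoly x nu j)) coef_poly; case: ltnP => le; last first.
  by rewrite nth_default // mul0r mulr0.
rewrite -[B`_j](divpK (cotpoly_dvd j dv)) -/(q j).
by rewrite -mulrA cotpoly_nodal mulrCA.
Qed.

Lemma linked_eq0 B H : linked B H -> (B == 0) = (H == 0).
Proof.
move=> L; apply/eqP/eqP => E; apply/polyP => j; rewrite coef0; have /eqP := L j.
  by rewrite E coef0 mul0r eq_sym mulf_eq0 (negbTE psi_neq0) => /eqP.
by rewrite E coef0 mulr0 mulf_eq0 expf_eq0 (negbTE nodal_neq0) andbF orbF => /eqP.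
Qed.

Lemma linked_comp B H : linked B H -> B \Po (g *: 'X) = psi x nu *: H.
Proof. by move=> L; apply/polyP => j; rewrite coef_comp_scaleX coefZ. Qed.

(** Here [A] is the polynomial of condition (3). Cancelling the powers of X - x_i from the link
    leaves factors that are nonzero at x_i. *)
Lemma linked_node_comp B H A i : linked B H ->
    (forall j, A`_j * ('X - (x i)%:P) ^+ j = ('X - (x i)%:P) ^+ nu i * H`_j) ->
  B \Po (nodal_except i *: 'X) = psi_except i *: A.
Proof.
move=> L EA; apply/polyP => j; rewrite coef_comp_scaleX coefZ.
have nz: ('X - (x i)%:P) ^+ j != 0 by rewrite expf_neq0 // polyXsubC_eq0.
apply: (mulIf nz); rewrite -[RHS]mulrA EA mulrA [psi_except i * _]mulrC -psiE -L.
by rewrite (nodalE i) exprMn mulrAC mulrA.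
Qed.

(** The division is exact because nu_i + [j - nu_i]^+ >= j. *)
Lemma t_form_node H i : t_form H ->
  exists A, forall j, A`_j * ('X - (x i)%:P) ^+ j = ('X - (x i)%:P) ^+ nu i * H`_j.
Proof.
case=> n [q ->]; set l := 'X - _.
exists (\poly_(j < n) ((l ^+ nu i * (q j * tpoly x nu j)) %/ l ^+ j)) => j.
rewrite -(poly_def n (fun j => q j * tpoly x nu j)) !coef_poly.
case: ifP => _; last by rewrite mul0r mulr0.
rewrite divpK // /tpoly (bigD1 i) //= mulrCA [l ^+ _ * (_ * _)]mulrA -exprD.
by rewrite dvdp_mull // dvdp_mulr // dvdp_exp2l //; lia.
Qed.

(** Degrees in the link give deg B_j + j k = deg psi + deg H_j; subtracting j turns weight k - 1 for
    Y into weight -1. *)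
Lemma linked_weight_le B H d : linked B H ->
  weight_le 1 (k%:Z - 1) d B <-> weight_le 1 (-1) (d - (size (psi x nu)).-1%:Z) H.
Proof.
move=> L; rewrite !weight_le1P.
have nz j : (B`_j == 0) = (H`_j == 0).
  have /(congr1 (fun p => p == 0)) := L j.
  by rewrite !mulf_eq0 expf_eq0 (negbTE nodal_neq0) andbF orbF (negbTE psi_neq0).
have sz j : B`_j != 0 -> (size (B`_j)%R + j * k = size (psi x nu) + size (H`_j)%R - 1)%N.
  move=> nzB; have := congr1 (fun p : {poly F} => size p) (L j).
  rewrite !size_mul ?expf_neq0 ?nodal_neq0 ?psi_neq0 -?nz //.
  have := size_exp g j; rewrite size_nodal /= => sz.
  have: size (g ^+ j) != 0%N by rewrite size_poly_eq0 expf_neq0 // nodal_neq0.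
  move: sz; move: (size (g ^+ j)) (size (B`_j)%R) (size (H`_j)%R) (size (psi x nu)) => a b c d'.
  lia.
have pos (p : {poly F}) : p != 0 -> (0 < size p)%N by rewrite size_poly_gt0.
have sz_psi := pos _ psi_neq0.
split=> h j nzj.
  have nzB : B`_j != 0 by rewrite nz.
  have := h j nzB; have := sz j nzB; have := pos _ nzj; have := pos _ nzB.
  rewrite mulrBr mulr1 mulrN1 -PoszM.
  move: (size (B`_j)%R) (size (H`_j)%R) (size (psi x nu)) sz_psi => b c d'; lia.
have nzH : H`_j != 0 by rewrite -nz.
have := h j nzH; have := sz j nzj; have := pos _ nzj; have := pos _ nzH.
rewrite mulrBr mulr1 mulrN1 -PoszM.
move: (size (B`_j)%R) (size (H`_j)%R) (size (psi x nu)) sz_psi => b c d'; lia.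
Qed.

End Reencoding.

(** * Transfer of feasibility between the two problems *)

Section Feasibility.
Variables (F : finFieldType) (k : nat) (x y : 'I_k -> F).
Variables (P : {set F * F}) (m : F * F -> nat) (nu : 'I_k -> nat) (e : {poly F}).
Hypotheses (x_inj : injective x) (nuE : forall i, nu i = m (x i, y i)).
Hypothesis eE : forall i, e.[x i] = y i.
Implicit Types (A B H Q : {poly {poly F}}) (p : F * F).

Local Notation R := (reencoding_points x y).
Local Notation denominator a := (if a \in codom x then (nodal x)^`().[a] else (nodal x).[a]).

Lemma denominator_neq0 a : denominator a != 0.
Proof.
case: ifPn => [/codomP[i ->]|]; last exact: nodal_off_nodes.
by rewrite deriv_nodal nodal_except_neq0.
Qed.

(** The denominator is nonzero and depends only on the abscissa. Injectivity ensures that [m_star]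
    picks the intended source point. *)
Lemma reduce_point_inj : injective (reduce_point x e).
Proof.
move=> [a b] [a' b'] [] /= <- /(divIf (denominator_neq0 a)) /addIr <- //.
Qed.

Lemma reduce_pointK p : denominator p.1 * (reduce_point x e p).2 = p.2 - e.[p.1].
Proof. by rewrite mulrC divfK // denominator_neq0. Qed.

Lemma m_star_reduce p : p \in P :\: R -> m_star x y P m e (reduce_point x e p) = m p.
Proof.
move=> pPR; rewrite /m_star; case: pickP => [p' /andP[_ /eqP/reduce_point_inj -> //]|].
by move/(_ p); rewrite pPR eqxx.
Qed.

Lemma feasible_axis_divisible Q :
  R \subset P -> IP_feasible P m Q -> axis_divisible x nu (Q \Po ('X + e%:P)).
Proof.
move=> RP [_ vQ] i; apply/vanishes_axisP; rewrite nuE.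
have xyP : (x i, y i) \in P by apply: (subsetP RP); apply: imset_f.
by have /vanishes_mu/(vanishes_shiftY _ _ _ e) := vQ _ xyP; rewrite /= eE subrr.
Qed.

Lemma feasible_reduced B H Q : B = Q \Po ('X + e%:P) ->
    linked x nu B H -> t_form x nu H -> IP_feasible P m Q ->
  RIP_feasible x nu (S_star x y P e) (T_star x y P e) (m_star x y P m e) H.
Proof.
move=> EB L tH [nzQ vQ].
have nzB : B != 0 by rewrite EB comp_poly_eq0 // size_XaddC.
have nzH : H != 0 by rewrite -(linked_eq0 L).
have vB p : p \in P :\: R -> vanishes p.1 (p.2 - e.[p.1]) (m p) B.
  by case/setDP=> pP _; rewrite EB; apply/(vanishes_shiftY p.1 p.2)/vanishes_mu/vQ.
split=> // [_ /imsetP[p pS ->]|_ i /imsetP[p pT ->] xp'].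
  move: pS; rewrite inE => /andP[pPR off]; rewrite m_star_reduce //.
  apply/vanishesP=> //; apply/(vanishes_link _ _ (nodal_off_nodes off)
    (psi_off_nodes nu off) (linked_comp L)).
  have := reduce_pointK p; rewrite (negbTE off) => ->; exact: vB.
move: pT; rewrite inE => /andP[pPR on]; rewrite m_star_reduce //.
have xp : p.1 = x i by [].
have [A EA] := t_form_node i tH; exists A; rewrite xp'; split.
  by apply/toFX_scaleP => //; rewrite polyXsubC_eq0.
have lk := linked_node_comp L EA.
(* If [A] were 0, B(X, c Y) would be 0 with c = [nodal_except x i] nonzero, forcing B = 0. *)
have nzA : A != 0.
  apply: contraNneq nzB => A0; move/eqP: lk.
  rewrite A0 scaler0; apply: contraTT => nzB'.
  by rewrite comp_poly_eq0 // size_scale ?size_polyX //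
    (contraNneq _ (nodal_except_neq0 x_inj i)) // => ->; rewrite horner0.
apply/vanishesP => //; apply/(vanishes_link _ _ (nodal_except_neq0 x_inj i)
  (psi_except_neq0 nu x_inj i) lk).
have := reduce_pointK p; rewrite on xp deriv_nodal => ->; rewrite -xp; exact: vB.
Qed.

Lemma feasible_reencoded B H Q : R \subset P -> B = Q \Po ('X + e%:P) ->
    linked x nu B H -> axis_divisible x nu B ->
    RIP_feasible x nu (S_star x y P e) (T_star x y P e) (m_star x y P m e) H ->
  IP_feasible P m Q.
Proof.
move=> RP EB L dv [nzH _ vS vT].
have nzQ : Q != 0.
  by move: nzH; rewrite -(linked_eq0 L) EB comp_poly_eq0 // size_XaddC.
split=> // p pP; apply/vanishesP => //; apply/(vanishes_shiftY _ _ _ e); rewrite -EB.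
(* Points of R become (x_i, 0), where divisibility of the coefficients of B suffices; the others are
   split by whether the abscissa is a node. *)
have [/imsetP[i _ ->] /=|pR] := boolP (p \in R).
  by rewrite eE subrr -nuE; apply/vanishes_axisP => j; apply: dv.
have pPR : p \in P :\: R by apply/setDP.
have [on|off] := boolP (p.1 \in codom x).
  have pT : reduce_point x e p \in T_star x y P e.
    by apply: imset_f; rewrite inE pPR.
  have /codomP[i xp] := on.
  have [A [/toFX_scaleP EA]] := vT _ i pT xp; rewrite m_star_reduce // => /vanishes_mu /= vA.
  rewrite /= xp polyXsubC_eq0 in EA; have {}EA := EA isT.
  have := reduce_pointK p; rewrite on xp deriv_nodal => <-.
  apply/(vanishes_link _ _ (nodal_except_neq0 x_inj i)
    (psi_except_neq0 nu x_inj i) (linked_node_comp L EA)).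
  by rewrite -xp.
have pS : reduce_point x e p \in S_star x y P e.
  by apply: imset_f; rewrite inE pPR.
have := vS _ pS; rewrite m_star_reduce // => /vanishes_mu /= vH.
have := reduce_pointK p; rewrite (negbTE off) => <-.
by apply/(vanishes_link _ _ (nodal_off_nodes off) (psi_off_nodes nu off) (linked_comp L)).
Qed.

End Feasibility.

Theorem theorem9 (F : finFieldType) (D : {set F}) (k : nat)
    (hk : (1 <= k <= #|D|)%N)
    (P : {set F * F}) (m : F * F -> nat)
    (hPD : forall p : F * F, p \in P -> p.1 \in D)
    (hm : forall p : F * F, p \in P -> (0 < m p)%N)
    (x y : 'I_k -> F) (hx : injective x)
    (hR : reencoding_points x y \subset P)
    (nu : 'I_k -> nat) (hnu : forall i : 'I_k, nu i = m (x i, y i))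
    (e : {poly F}) (he_size : (size e <= k)%N)
    (he : forall i : 'I_k, e.[x i] = y i)
    (H : {poly {poly F}})
    (hH : RIP_solution x 1 (-1) nu (S_star x y P e) (T_star x y P e)
            (m_star x y P m e) H) :
  exists Q : {poly {poly F}},
    toFX Q = tofrac (psi x nu)
               *: (toFX H \Po ((tofrac (nodal x))^-1 *: ('X - (tofrac e)%:P)))
    /\ IP_solution 1 (k%:Z - 1) P m Q.
Proof.
case: hH => fH minH; have [nzH tH _ _] := fH.
have [B [dv L]] := t_form_linked tH; pose Q := B \Po ('X - e%:P).
have EB : B = Q \Po ('X + e%:P).
  by rewrite -comp_polyA comp_polyB comp_polyX comp_polyC addrK comp_polyXr.
have fQ := feasible_reencoded hx hnu he hR EB L dv fH.
exists Q; split; last split=> // A fA.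
  have EF : toFX B = tofrac (psi x nu) *: (toFX H \Po ((tofrac (nodal x))^-1 *: 'X)).
    by apply/toFX_scaleP => //; apply: nodal_neq0.
  rewrite /toFX map_comp_poly -/(toFX B) EF comp_polyZ -comp_polyA.
  by rewrite comp_polyZ comp_polyX rmorphB /= map_polyX map_polyC.
(* A competitor [A] is sent to a feasible [H'], and minimality gives wdeg H <= wdeg H' <= wdeg A -
   deg psi. Adding deg psi back bounds B, and then Q, by wdeg A. *)
have [H' [tH' L']] := axis_divisible_linked hx (feasible_axis_divisible hnu he hR fA).
have fH' := feasible_reduced y hx erefl L' tH' fA.
apply/wdeg_leP; rewrite ?fQ.1 // /Q -polyCN.
apply: weight_le_shiftY; first by rewrite size_polyN.
apply/(linked_weight_le _ L)/wdeg_leP => //; apply: le_trans (minH _ fH') _.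
apply/wdeg_leP; first by case: fH'.
by apply/(linked_weight_le _ L'); apply: weight_le_shiftY => //; apply/wdeg_leP; case: fA.
Qed.
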